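(* For all integers $J\ge 2$ and $N\ge 0$, $$MO(-1,2^J-2;3N+2)\equiv 0\pmod 4.$$
   Context: For an integer $a$ and a nonnegative integer $t$, define $MO(a,t;n)$ by the formal power series identity $$\sum_{n\ge 0}MO(a,t;n)\,q^n=\sum_{1\le n_1<n_2<\cdots<n_t}\frac{q^{n_1+n_2+\cdots+n_t}}{\prod_{k=1}^t(1+aq^{n_k}+q^{2n_k})},$$ where each factor $1/(1+aq^{m}+q^{2m})$ is expanded as a power series in $q$ with integer coefficients. *)

(* Defs.v *)
From mathcomp Require Import all_boot all_order all_algebra.

Set Implicit Arguments.
Unset Strict Implicit.
Unset Printing Implicit Defensive.

Import GRing.Theory.
Local Open Scope ring_scope.

(* A power series in q with integer coefficients, given by n |-> [q^n] f. *)
Definition fps := nat -> int.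

Definition fps1 : fps := fun n => (n == 0%N)%:R.

Definition fps_mul (f g : fps) : fps :=
  fun n => \sum_(i < n.+1) f i * g (n - i)%N.

Definition fps_of_poly (p : {poly int}) : fps := fun n => p`_n.

(* 1 / p = \sum_(k >= 0) (1 - p)^k, meaningful when p`_0 = 1: the powers with
   k > n do not contribute to the coefficient of q^n. *)
Definition fps_inv_poly (p : {poly int}) : fps :=
  fun n => (\sum_(k < n.+1) (1 - p) ^+ k)`_n.

Definition MO_term (a : int) (s : seq nat) : fps :=
  fps_mul (fps_of_poly 'X^(sumn s))
    (\big[fps_mul/fps1]_(m <- s)
        fps_inv_poly (1 + a *: 'X^m + 'X^(2 * m))).

(* The index set 1 <= n_1 < ... < n_t is infinite, but MO_term a s has no term
   of degree < n_1 + ... + n_t, so that only the n_1, ..., n_t <= n contribute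
   to the coefficient of q^n: see MO_has_sum below. *)
Definition MO (a : int) (t n : nat) : int :=
  \sum_(s : t.-tuple 'I_n.+1 | path ltn 0 (map val s)) MO_term a (map val s) n.

(* f = \sum_(i | P i) F i as formal power series. *)
Definition fps_has_sum (I : eqType) (P : pred I) (F : I -> fps) (f : fps) :=
  forall n : nat, exists r : seq I,
    [/\ uniq r,
        all P r,
        forall i : I, P i -> i \notin r -> F i n = 0
      & f n = \sum_(i <- r) F i n].

Lemma coef_exp_small (p : {poly int}) (n k : nat) :
  p`_0 = 0 -> (n < k)%N -> (p ^+ k)`_n = 0.
Proof.
move=> p0; elim: k n => // k IHk n lt_nk.
rewrite exprS coefM big_ord_recl p0 mul0r add0r big1 // => i _.
rewrite IHk ?mulr0 //=; apply: leq_trans (_ : n <= k)%N => //.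
by rewrite ltn_subrL /= (leq_ltn_trans _ (ltn_ord i)).
Qed.

Lemma fps_inv_polyE (p : {poly int}) (n m : nat) :
  p`_0 = 1 -> (n <= m)%N ->
  fps_inv_poly p n = (\sum_(k < m.+1) (1 - p) ^+ k)`_n.
Proof.
move=> p0 /subnK <-; rewrite /fps_inv_poly.
elim: (m - n)%N => [|d IHd] //; rewrite IHd addSn [in RHS]big_ord_recr coefD.
rewrite (@coef_exp_small _ n) ?addr0 ?ltnS ?leq_addl //.
by rewrite coefB coef1 p0 subrr.
Qed.

Lemma fps_mul_inv_poly (p : {poly int}) :
  p`_0 = 1 -> fps_mul (fps_of_poly p) (fps_inv_poly p) =1 fps1.
Proof.
move=> p0 n; rewrite /fps_mul.
under eq_bigr => i _ do rewrite (fps_inv_polyE p0 (leq_subr i n)).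
rewrite -coefM -[p in p * _](subKr 1).
rewrite -[1 - _ in LHS]opprB mulNr -subrX1 opprB coefB coef1.
by rewrite coef_exp_small ?subr0 // coefB coef1 p0 subrr.
Qed.

Lemma MO_denom0 (a : int) (m : nat) :
  (0 < m)%N -> (1 + a *: 'X^m + 'X^(2 * m) : {poly int})`_0 = 1.
Proof.
case: m => // m _.
by rewrite !coefD coefZ !coefXn coef1 /= mulr0 !addr0.
Qed.

Lemma MO_term_small (a : int) (s : seq nat) (n : nat) :
  (n < sumn s)%N -> MO_term a s n = 0.
Proof.
move=> lt_ns; rewrite /MO_term /fps_mul big1 // => i _.
rewrite /fps_of_poly coefXn ltn_eqF ?mul0r //.
by rewrite (leq_trans (ltn_ord i)).
Qed.

Lemma MO_has_sum (a : int) (t : nat) :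
  fps_has_sum (fun s : t.-tuple nat => path ltn 0 s) (fun s => MO_term a s)
    (MO a t).
Proof.
move=> n; pose w (s : t.-tuple 'I_n.+1) : t.-tuple nat := map_tuple val s.
exists [seq w s | s <- enum {: t.-tuple 'I_n.+1} & path ltn 0 (w s)]; split.
- rewrite map_inj_uniq ?filter_uniq -?enumT ?enum_uniq // => s1 s2 /(congr1 val) /=.
  by move=> /(inj_map val_inj) /val_inj.
- by apply/allP => _ /mapP[s + ->]; rewrite mem_filter => /andP[].
- move=> s Ps; apply: contraNeq => nz.
  have le_s i : i \in (s : seq nat) -> (i < n.+1)%N.
    move=> s_i; rewrite ltnS; apply: contraNT nz; rewrite -ltnNge => lt_ni.
    apply/eqP/MO_term_small/(leq_trans lt_ni).
    by rewrite sumnE (big_rem i) //= leq_addr.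
  have Ew : w (map_tuple inord s) = s.
    apply: val_inj => /=; rewrite -map_comp -[RHS]map_id.
    by apply/eq_in_map => i /le_s /= /inordK.
  by apply/mapP; exists (map_tuple inord s); rewrite // mem_filter Ew Ps mem_enum.
- by rewrite big_map big_filter /MO /= big_enum_cond.
Qed.

(* Main.v *)
(* With z marking t, the generating series of MO(-1, t; n) is the product over m
   of (1 + (z - 1) q^m + q^(2m)) / (1 - q^m + q^(2m)). By the Jacobi triple
   product its numerator, times prod (1 - q^m), is the sum of q^(k(k+1)/2) P_k(z)
   where P_0 = 1, P_1 = z - 2 and P_(k+1) = (z - 1) P_k - P_(k-1). Since
   (1 - q^m + q^(2m)) (1 + q^m) = 1 + q^(3m), it follows that
     prod (1 + q^(3m)) * sum_(t, n) MO(-1, t; n) z^t q^n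
       = D(q) * sum_k q^(k(k+1)/2) P_k(z),  D = prod (1 + q^m) / (1 - q^m),
   and the first factor does not mix residues of exponents modulo 3.
   Modulo 4, D is 1 + 2 sum d(i) q^i, so D_i is even for i > 0 and divisible by
   4 for i = 2 mod 3, such an i not being a square. If k <> 1 mod 3, then 3
   divides k(k+1)/2, which leaves a coefficient D_i with i = 2 mod 3. If
   k = 1 mod 3, then k(k+1)/2 = 1 mod 3, so that i = 1 mod 3 and D_i is even;
   the z^t-coefficient of P_k is also even, because the generating series in w
   of these coefficients is w^t (1 - w) / (1 + w + w^2)^(t+1), which is
   w^t (1 + w)^(t+2) / (1 + w^3)^(t+1) modulo 2, and (1 + w)^(2^J) = 1 + w^(2^J)
   modulo 2 while neither 2^J - 2 nor 2^(J+1) - 2 is 1 mod 3. *)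
Require Import Defs.
From mathcomp Require Import all_boot all_order all_algebra.
From mathcomp Require Import ring zify.

Set Implicit Arguments.
Unset Strict Implicit.
Unset Printing Implicit Defensive.

Import GRing.Theory.
Local Open Scope ring_scope.

(** * Congruence modulo an element of a ring *)

Section CongruenceModElement.
Variable R : comNzRingType.
Implicit Types x f g h q : R.

(* With [x = q^(n+1)] this is equality of power series in q up to degree n. *)
Definition eqmodr x f g := exists h, f = g + x * h.

Lemma eqmodr_refl x f : eqmodr x f f.
Proof. by exists 0; rewrite mulr0 addr0. Qed.

Lemma eqmodr_trans x f g h : eqmodr x f g -> eqmodr x g h -> eqmodr x f h.
Proof. by case=> a -> [b ->]; exists (a + b); ring. Qed.

Lemma eqmodrM x f g f' g' :
  eqmodr x f g -> eqmodr x f' g' -> eqmodr x (f * f') (g * g').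
Proof. by case=> a -> [b ->]; exists (a * g' + g * b + x * a * b); ring. Qed.

Lemma eqmodrD x f g f' g' :
  eqmodr x f g -> eqmodr x f' g' -> eqmodr x (f + f') (g + g').
Proof. by case=> a -> [b ->]; exists (a + b); ring. Qed.

Lemma eqmodrMl x f g h : eqmodr x f g -> eqmodr x (h * f) (h * g).
Proof. exact/eqmodrM/eqmodr_refl. Qed.

Lemma eqmodr_prod x n (F G : 'I_n -> R) :
  (forall i, eqmodr x (F i) (G i)) -> eqmodr x (\prod_i F i) (\prod_i G i).
Proof.
move=> FG; apply: (big_ind2 (eqmodr x)) => // *; first exact: eqmodr_refl.
exact: eqmodrM.
Qed.

Lemma eqmodr_sum x n (F G : 'I_n -> R) :
  (forall i, eqmodr x (F i) (G i)) -> eqmodr x (\sum_i F i) (\sum_i G i).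
Proof.
move=> FG; apply: (big_ind2 (eqmodr x)) => // *; first exact: eqmodr_refl.
exact: eqmodrD.
Qed.

(** As [u] is 1 plus a multiple of [q], a truncated geometric series inverts it modulo [q ^+ n]. *)
Lemma eqmodr_mulI q n u f g : eqmodr q u 1 ->
  eqmodr (q ^+ n) (u * f) (u * g) -> eqmodr (q ^+ n) f g.
Proof.
case=> h Du [k E]; pose v := \sum_(i < n) (- (q * h)) ^+ i.
have uv : u * v = 1 - q ^+ n * (- h) ^+ n.
  have -> : u = - (- (q * h) - 1) by rewrite Du; ring.
  rewrite mulNr -subrX1 (_ : (- (q * h)) ^+ n = q ^+ n * (- h) ^+ n); first by ring.
  by rewrite -exprMn mulrN.
exists (v * k + (- h) ^+ n * (f - g)).
suff : f - g = q ^+ n * (v * k + (- h) ^+ n * (f - g)) by move=> <-; ring.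
have -> : q ^+ n * (v * k + (- h) ^+ n * (f - g))
    = v * (u * g + q ^+ n * k - u * g) + (1 - u * v) * (f - g) by rewrite uv; ring.
by rewrite -E; ring.
Qed.

End CongruenceModElement.

(** * Finite form of the Jacobi triple product *)

Section FiniteTripleProduct.
Variables (R : comNzRingType) (q y : R).

Definition qfact n : R := \prod_(i < n) (1 - q ^+ i.+1).

Lemma qfactS n : qfact n.+1 = qfact n * (1 - q ^+ n.+1).
Proof. by rewrite /qfact big_ord_recr. Qed.

(* The coefficient of [P k] in the product of the [1 + y * q^i + q^(2 i)] for
   [1 <= i <= n]; by symmetry [k.-1 = 0] stands for the index -1 when k = 0. *)
Fixpoint jcoef n k : R :=
  if n is n'.+1 then
    (1 + q ^+ n'.+1 ^+ 2) * jcoef n' k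
      + q ^+ n'.+1 * (jcoef n' k.-1 + jcoef n' k.+1)
  else (k == 0%N)%:R.

Lemma jcoef_gt n k : (n < k)%N -> jcoef n k = 0.
Proof.
elim: n k => [|n IHn] k /=; first by case: k.
by move=> lt_nk; rewrite !IHn ?addr0 ?mulr0 ?addr0 //; lia.
Qed.

(** Up to a power of [q], [jcoef n k] is the Gaussian binomial coefficient of 2n+1 over n-k.
    Denominators are multiplied out, as [R] is an arbitrary commutative ring. *)
Lemma jcoefE n k : (k <= n)%N ->
  qfact (n - k) * qfact (n + k).+1 * jcoef n k
    = q ^+ 'C(k.+1, 2) * qfact n.*2.+1.
Proof.
elim: n k => [|n IHn] k le_kn.
  have -> : k = 0%N by lia.
  by rewrite /= /qfact big_ord0; ring.
set N := qfact _ * qfact _; set T := q ^+ 'C(_, _).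
have E0 : N * jcoef n k = (1 - q ^+ (n.+1 - k)) * (1 - q ^+ (n + k).+2)
    * (T * qfact n.*2.+1).
  have [le|lt] := leqP k n; last first.
    rewrite jcoef_gt // (_ : n.+1 - k = 0)%N ?expr0 ?subrr; last by lia.
    by ring.
  rewrite /N -IHn // subSn // addSn.
  by rewrite [qfact _.+2]qfactS [qfact (_ - _).+1]qfactS; ring.
have E1 : N * jcoef n k.-1 = (1 - q ^+ (n + k).+1) * (1 - q ^+ (n + k).+2)
    * (q ^+ 'C(k.-1.+1, 2) * qfact n.*2.+1).
  rewrite -IHn; last by lia.
  rewrite /N; case: k {E0 N T} le_kn => [|k] le_kn /=.
    by rewrite !subn0 !addn0 !qfactS; ring.
  by rewrite subSS !addnS addSn !qfactS; ring.
have E2 : N * jcoef n k.+1 = (1 - q ^+ (n.+1 - k)) * (1 - q ^+ (n - k))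
    * (q ^+ 'C(k.+2, 2) * qfact n.*2.+1).
  have [lt|le] := ltnP k n; last first.
    rewrite jcoef_gt //; have [->|->] : k = n \/ k = n.+1 by lia.
      by rewrite subnn expr0; ring.
    by rewrite subnn expr0; ring.
  rewrite -IHn // /N.
  rewrite (_ : n.+1 - k = (n - k.+1).+2)%N; last by lia.
  rewrite (_ : n - k = (n - k.+1).+1)%N; last by lia.
  by rewrite !qfactS addSn addnS !qfactS; ring.
have -> : N * jcoef n.+1 k = (1 + q ^+ n.+1 ^+ 2) * (N * jcoef n k)
    + q ^+ n.+1 * (N * jcoef n k.-1 + N * jcoef n k.+1) by rewrite /=; ring.
rewrite E0 E1 E2 doubleS 2![qfact _.+1 in RHS]qfactS.
pose u := q ^+ (n.+1 - k); pose v := q ^+ k.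
have Dn : q ^+ n.+1 = u * v by rewrite -exprD subnK.
have D1 : q ^+ (n + k).+1 = u * v * v by rewrite -Dn -exprD addSn.
have D2 : q ^+ (n + k).+2 = q * (u * v * v) by rewrite exprS D1.
have D3 : q ^+ n.*2.+2 = (u * v) ^+ 2 by rewrite -Dn -exprM; congr (_ ^+ _); lia.
have D4 : q ^+ n.*2.+3 = q * (u * v) ^+ 2 by rewrite exprS D3.
have D5 : T = v * q ^+ 'C(k.-1.+1, 2).
  by rewrite /T /v -exprD; case: (k) => // j; rewrite binS bin1 addnC.
have D6 : q ^+ 'C(k.+2, 2) = q * v * T by rewrite /T binS bin1 exprD exprS mulrC.
(* For k = n+1, truncated subtraction makes [q * q ^+ (n - k)] differ from [u]; the factor 1 - u,
   which is then zero, absorbs this. *)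
have D7 : (1 - u) * (q * q ^+ (n - k)) = (1 - u) * u.
  have [le|lt] := leqP k n; first by rewrite -exprS /u subSn.
  by rewrite /u (_ : n.+1 - k = 0)%N ?expr0 ?subrr ?mul0r //; lia.
rewrite D6 D1 D2 D3 D4 Dn -/u.
set T' := q ^+ 'C(k.-1.+1, 2) in D5 *; set Q := qfact _; set r := q ^+ (n - k) in D7 *.
have -> : (1 - u) * (1 - r) * (q * v * T * Q)
  = ((1 - u) * q - (1 - u) * (q * r)) * (v * T * Q) by ring.
rewrite D7 D5; ring.
Qed.

Variable P : nat -> R.
Hypothesis P0 : P 0 = 1.
Hypothesis P_rec : forall k, y * P k = P k.+1 + P k.-1.

Lemma jprod_expand n :
  \prod_(i < n) (1 + y * q ^+ i.+1 + q ^+ i.+1 ^+ 2)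
    = \sum_(k < n.+1) jcoef n k * P k.
Proof.
elim: n => [|n IHn]; first by rewrite big_ord0 big_ord1 P0 mulr1.
rewrite big_ord_recr /= IHn.
have ext (F : nat -> R) : (forall k, (n < k)%N -> F k = 0) ->
    \sum_(k < n.+1) F k = \sum_(k < n.+2) F k.
  by move=> F0; rewrite [RHS]big_ord_recr /= F0 ?addr0.
pose b := jcoef n.
have S1 : \sum_(k < n.+2) b k * P k = \sum_(k < n.+1) b k * P k.
  by rewrite -(ext (fun k => b k * P k)) // => k ?; rewrite /b jcoef_gt ?mul0r.
have S2 : y * (\sum_(k < n.+1) b k * P k)
    = \sum_(k < n.+2) (b k.-1 + b k.+1) * P k.
  rewrite mulr_sumr.
  under eq_bigr => k _ do rewrite mulrCA P_rec mulrDr.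
  under [RHS]eq_bigr => k _ do rewrite mulrDl.
  rewrite !big_split /= [X in _ + X = _](ext (fun k => b k * P k.-1)); last first.
    by move=> k ?; rewrite /b jcoef_gt ?mul0r.
  (* The k = 0 term on the left, where P_(-1) = P_0, matches the k = 0 term with [b k.-1] on the
     right. *)
  rewrite [X in _ + X = _]big_ord_recl [X in _ = X + _]big_ord_recl /=.
  rewrite [X in _ = _ + X]big_ord_recr /= /b.
  rewrite (jcoef_gt (_ : n < n.+2)%N) // mul0r addr0.
  under [X in _ + (_ + X) = _]eq_bigr => k _ do rewrite /bump add1n /=.
  under [X in _ = _ + X + _]eq_bigr => k _ do rewrite /bump add1n /=.
  ring.
rewrite /b in S1 S2.
under [RHS]eq_bigr => k _ do rewrite mulrDl -2!mulrA.
rewrite big_split /= -!mulr_sumr S1.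
rewrite -S2; ring.
Qed.

Lemma qfact1 n : eqmodr q (qfact n) 1.
Proof.
elim: n => [|n [h IHn]]; first by rewrite /qfact big_ord0; apply: eqmodr_refl.
by rewrite qfactS IHn exprS; exists (h - (1 + q * h) * q ^+ n); ring.
Qed.

Lemma qfactD m d : eqmodr (q ^+ m.+1) (qfact (m + d)) (qfact m).
Proof.
elim: d => [|d [h IHd]]; first by rewrite addn0; apply: eqmodr_refl.
rewrite addnS qfactS IHd -addSn exprD.
by exists (h - (qfact m + q ^+ m.+1 * h) * q ^+ d); ring.
Qed.

(** In [jcoefE], two of the factorials agree with [qfact n] modulo [q ^+ n.+1]. The third,
    [qfact (n - k)], agrees only modulo [q ^+ (n - k).+1]; the triangular power, of exponent at
    least k, makes up the loss. *)
Lemma qfact_jcoef n k : (k <= n)%N ->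
  eqmodr (q ^+ n.+1) (qfact n * jcoef n k) (q ^+ 'C(k.+1, 2)).
Proof.
move=> le_kn; have [d Dd] : exists d, ('C(k.+1, 2) + (n - k).+1 = n.+1 + d)%N.
  exists ('C(k.+1, 2) - k)%N.
  by case: k le_kn => [|k] le; [rewrite bin_small | rewrite binS bin1]; lia.
have E := jcoefE le_kn.
have [h1 D1] := qfactD n k.+1; have [h2 D2] := qfactD n n.+1.
have [h3 D3] := qfactD (n - k) k; rewrite subnK // in D3.
rewrite addnS in D1; rewrite addnS addnn in D2; rewrite D1 D2 in E.
set b := jcoef n k in E *; set T := q ^+ 'C(_, _) in E *.
apply: (eqmodr_mulI (qfact1 (n - k))).
have -> : qfact (n - k) * (qfact n * b)
   = qfact (n - k) * (qfact n + q ^+ n.+1 * h1) * b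
     - q ^+ n.+1 * (h1 * qfact (n - k) * b) by ring.
rewrite E {1}D3.
have Ed : q ^+ (n - k).+1 * T = q ^+ n.+1 * q ^+ d by rewrite -!exprD addnC Dd.
exists (h3 * q ^+ d + T * h2 - h1 * qfact (n - k) * b).
have -> : T * (qfact (n - k) + q ^+ (n - k).+1 * h3 + q ^+ n.+1 * h2)
  = qfact (n - k) * T + h3 * (q ^+ (n - k).+1 * T) + q ^+ n.+1 * h2 * T by ring.
by rewrite Ed; ring.
Qed.

Lemma triple_product n : eqmodr (q ^+ n.+1)
  (qfact n * \prod_(i < n) (1 + y * q ^+ i.+1 + q ^+ i.+1 ^+ 2))
  (\sum_(k < n.+1) q ^+ 'C(k.+1, 2) * P k).
Proof.
rewrite jprod_expand mulr_sumr; apply: eqmodr_sum => k; rewrite mulrA.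
apply: eqmodrM (eqmodr_refl _ _); apply: qfact_jcoef.
by rewrite -ltnS.
Qed.

End FiniteTripleProduct.

(** * The product identity for the generating series *)

(* [1 + 2 * \sum_j q^(m j)] is the truncation of [(1 + q^m) / (1 - q^m)]. *)
Lemma MO_product_congr (R : comNzRingType) (q z : R) (I P : nat -> R) n :
    P 0 = 1 -> (forall k, (z - 1) * P k = P k.+1 + P k.-1) ->
    (forall m, (0 < m)%N ->
       eqmodr (q ^+ n.+1) ((1 - q ^+ m + q ^+ m ^+ 2) * I m) 1) ->
  eqmodr (q ^+ n.+1)
    (\prod_(i < n) (1 + q ^+ i.+1 ^+ 3)
      * \prod_(i < n) (1 + z * (q ^+ i.+1 * I i.+1)))
    (\prod_(i < n) (1 + 2 * \sum_(j < n) q ^+ i.+1 ^+ j.+1)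
      * \sum_(k < n.+1) q ^+ 'C(k.+1, 2) * P k).
Proof.
move=> P0 P_rec pI; apply: (eqmodr_mulI (qfact1 q n)).
(* With c = q^(i+1), (1 - c)(1 + c^3) = (1 - c^2)(1 - c + c^2), and the last factor cancels
   [I i.+1]. *)
apply: (@eqmodr_trans _ _ _ (\prod_(i < n) (1 + q ^+ i.+1) * (qfact q n *
    \prod_(i < n) (1 + (z - 1) * q ^+ i.+1 + q ^+ i.+1 ^+ 2)))).
  rewrite /qfact -!big_split; apply: eqmodr_prod => i /=.
  have [h Eh] := pI i.+1 isT; set c := q ^+ i.+1 in Eh *.
  exists ((1 - c ^+ 2) * z * c * h).
  have -> : (1 - c) * ((1 + c ^+ 3) * (1 + z * (c * I i.+1)))
    = (1 - c ^+ 2) * (1 - c + c ^+ 2 + z * c * ((1 - c + c ^+ 2) * I i.+1)) by ring.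
  by rewrite Eh; ring.
apply: eqmodr_trans (eqmodrMl _ (triple_product q P0 P_rec n)) _.
rewrite mulrA; apply: eqmodrM (eqmodr_refl _ _); rewrite /qfact -big_split.
apply: eqmodr_prod => i /=; set c := q ^+ i.+1.
(* Truncating the geometric series leaves the error 2 c^(n+1), a multiple of q^(n+1). *)
exists (2 * q ^+ (i * n.+1)).
have -> : \sum_(j < n) c ^+ j.+1 = c * \sum_(j < n) c ^+ j.
  by rewrite mulr_sumr; apply: eq_bigr => j _; rewrite exprS.
have -> : (1 - c) * (1 + 2 * (c * \sum_(j < n) c ^+ j))
    = 1 - c - 2 * c * ((c - 1) * \sum_(j < n) c ^+ j) by ring.
rewrite -subrX1.
have -> : 1 - c - 2 * c * (c ^+ n - 1) = 1 + c - 2 * c ^+ n.+1 by rewrite exprS; ring.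
by rewrite mulrCA -exprD -mulSn exprM subrK.
Qed.

(** * Divisibility of coefficients *)

Lemma eqmodrXn_coef (A : comNzRingType) (f g : {poly A}) n i :
  eqmodr 'X^n f g -> (i < n)%N -> f`_i = g`_i.
Proof. by case=> h -> lt_in; rewrite coefD coefXnM lt_in addr0. Qed.

Lemma dvdz_mulrn (x : int) d : (d%:Z %| x *+ d)%Z.
Proof. by rewrite -mulr_natr natz dvdz_mull. Qed.

Lemma eqmodr_nat_coef (f g : {poly int}) d i :
  eqmodr d%:R f g -> (d%:Z %| g`_i)%Z -> (d%:Z %| f`_i)%Z.
Proof.
case=> h -> ?; rewrite coefD rpredD // mulr_natl coefMn.
exact: dvdz_mulrn.
Qed.

Lemma eqmodr_prod_1D2 (R : comNzRingType) n (F : 'I_n -> R) :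
  eqmodr 4%:R (\prod_i (1 + 2 * F i)) (1 + 2 * \sum_i F i).
Proof.
apply: (big_rec2 (fun x y => eqmodr 4%:R x (1 + 2 * y))).
  by rewrite mulr0 addr0; apply: eqmodr_refl.
by move=> i y1 y2 _ [h ->]; exists (h + F i * y2 + 2 * F i * h); ring.
Qed.

Lemma sum_sym_even n (f : nat -> nat -> int) :
    (forall i j, f i j = f j i) -> (forall i, f i i = 0) ->
  (2 %| \sum_(i < n) \sum_(j < n) f i j)%Z.
Proof.
move=> fC f0; elim: n => [|n IHn]; first by rewrite big_ord0.
rewrite big_ord_recr /= big_ord_recr /= f0 addr0.
under eq_bigr => i _ do rewrite big_ord_recr /= fC.
by rewrite big_split /= -addrA rpredD // -mulr2n; apply: dvdz_mulrn.
Qed.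

Definition dvd_off3 (d : int) (f : {poly int}) :=
  forall i, ~~ (3 %| i)%N -> (d %| f`_i)%Z.

Lemma dvd_off3M d f g : dvd_off3 d f -> dvd_off3 d g -> dvd_off3 d (f * g).
Proof.
move=> df dg i ni; rewrite coefM rpred_sum // => j _.
have [dvd_j|/df/dvdz_mulr->//] := boolP (3 %| j)%N.
apply/dvdz_mull/dg; apply: contra ni => dvd_ij.
by rewrite -(subnKC (_ : j <= i)%N) ?dvdn_add // -ltnS.
Qed.

Lemma dvd_off3_prod d n (F : 'I_n -> {poly int}) :
  (forall i, dvd_off3 d (F i)) -> dvd_off3 d (\prod_i F i).
Proof.
move=> dF; apply: big_ind => //; last by move=> ? ?; apply: dvd_off3M.
by move=> [|i] //; rewrite coef1.
Qed.

Lemma dvd_residue_mulI d (W f : {poly int}) n r :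
    W`_0 = 1 -> dvd_off3 d W ->
    (forall i, (i <= n)%N -> (i %% 3 = r)%N -> (d %| (W * f)`_i)%Z) ->
  forall i, (i <= n)%N -> (i %% 3 = r)%N -> (d %| f`_i)%Z.
Proof.
move=> W0 dW dWf; elim/ltn_ind=> i IHi le_in Ei.
have := dWf i le_in Ei; rewrite coefM big_ord_recl W0 mul1r subn0 rpredDr //.
apply: rpred_sum => j _; rewrite lift0.
have [dvd_j|/dW/dvdz_mulr->//] := boolP (3 %| j.+1)%N.
apply/dvdz_mull/IHi; have := ltn_ord j; lia.
Qed.

Lemma overpartition_coef n (k : nat) (D : {poly int}) :
    D = \prod_(i < n) (1 + 2 * \sum_(j < n) 'X ^+ i.+1 ^+ j.+1) ->
  ((0 < k)%N -> (2 %| D`_k)%Z) /\ ((k %% 3 = 2)%N -> (4 %| D`_k)%Z).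
Proof.
move=> ->; set S := \sum_(i < n) \sum_(j < n) 'X ^+ i.+1 ^+ j.+1 : {poly int}.
have E : eqmodr 4%:R (\prod_(i < n) (1 + 2 * \sum_(j < n) 'X ^+ i.+1 ^+ j.+1))
  (1 + 2 * S) by apply: eqmodr_prod_1D2.
have cE : (0 < k)%N -> (1 + 2 * S)`_k = 2 * S`_k.
  by move=> k_gt0; rewrite coefD coef1 gtn_eqF // add0r !mulr_natl coefMn.
split=> [k_gt0|k2].
  have [h ->] := E; rewrite coefD cE // [4%:R * h]mulr_natl coefMn (mulrnA _ 2 2).
  by apply: rpredD; [apply: dvdz_mulr | apply: dvdz_mulrn].
apply: (eqmodr_nat_coef E); rewrite cE; last by lia.
rewrite (_ : 4%:Z = 2 * 2) // dvdz_mul // /S coef_sum.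
under eq_bigr => i _ do rewrite coef_sum.
(* The coefficient of [S] counts the factorizations of k into two factors at most n. Swapping the
   factors pairs them up, since k, being 2 modulo 3, is not a square. *)
pose f i j : int := (k == i.+1 * j.+1)%N%:R.
rewrite (_ : \sum_i _ = \sum_(i < n) \sum_(j < n) f i j).
  apply: sum_sym_even => [i j|i]; first by rewrite /f mulnC.
  rewrite /f; case: eqP => // Ek; move: k2; rewrite Ek.
  rewrite -modnMm; have : (i.+1 %% 3 < 3)%N by rewrite ltn_mod.
  by case: (_ %% 3)%N => [|[|[|]]].
apply: eq_bigr => i _; apply: eq_bigr => j _.
by rewrite -exprM coefXn.
Qed.

(** * Parity of the coefficients of [jacobi_poly] *)

(* [P_k], so that [P_k (1 + x + 1/x)] is the sum of the [(-1)^(k - j) x^j]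
   for [-k <= j <= k]. *)
Fixpoint jacobi_poly (k : nat) : {poly int} :=
  match k with
  | 0 => 1
  | k'.+1 =>
      if k' is k''.+1 then ('X - 1) * jacobi_poly k' - jacobi_poly k''
      else 'X - 2
  end.

Lemma jacobi_poly_rec k :
  ('X - 1) * jacobi_poly k = jacobi_poly k.+1 + jacobi_poly k.-1.
Proof. by case: k => [|k] /=; ring. Qed.

Lemma map_jacobi_poly_rec k :
  ('X - 1) * (jacobi_poly k)^:P = (jacobi_poly k.+1)^:P + (jacobi_poly k.-1)^:P.
Proof. by rewrite -rmorphD -jacobi_poly_rec rmorphM rmorphB /= map_polyX rmorph1. Qed.

(** This is the generating function (1 - w) / (1 - y w + w^2) with its truncation error; the term -w
    comes from P_(-1) = P_0. *)
Lemma three_term_gf (R : comNzRingType) (w y : R) (P : nat -> R) L : P 0 = 1 ->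
    (forall k, y * P k = P k.+1 + P k.-1) ->
  (1 - y * w + w ^+ 2) * (\sum_(k < L) w ^+ k * P k)
    = 1 - w - w ^+ L * P L + w ^+ L.+1 * P L.-1.
Proof.
move=> P0 P_rec; elim: L => [|L IHL]; first by rewrite big_ord0 P0; ring.
rewrite big_ord_recr /= mulrDr IHL.
have -> : (1 - y * w + w ^+ 2) * (w ^+ L * P L)
  = (1 + w ^+ 2) * w ^+ L * P L - w ^+ L.+1 * (y * P L).
  by rewrite [w ^+ L.+1]exprS; ring.
by rewrite P_rec [w ^+ L.+2]exprS [w ^+ L.+1]exprS; ring.
Qed.

Lemma expr_2X_congr (R : comNzRingType) (w : R) J :
  eqmodr 2 ((1 + w) ^+ (2 ^ J)) (1 + w ^+ (2 ^ J)).
Proof.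
elim: J => [|J [h IHJ]]; first exact: eqmodr_refl.
rewrite expnSr !exprM IHJ; set c := w ^+ _.
by exists (c + 2 * h * (1 + c) + 2 * h ^+ 2); ring.
Qed.

Lemma jacobi_poly_coef_even J k : (0 < J)%N -> (k %% 3 = 1)%N ->
  (2 %| (jacobi_poly k)`_(2 ^ J - 2))%Z.
Proof.
move=> J_gt0 k1.
(* The generating polynomial, in a variable w, of the coefficients of z^t, cut off after w^k. *)
pose c t : {poly int} := \sum_(i < k.+1) 'X^i * ((jacobi_poly i)`_t)%:P.
have cE t : (c t)`_k = (jacobi_poly k)`_t.
  rewrite /c coef_sum big_ord_recr /= coefXnM ltnn subnn coefC.
  by rewrite big1 ?add0r // => i _; rewrite coefMC coefXn gtn_eqF ?mul0r.
pose P i : {poly {poly int}} := (jacobi_poly i)^:P.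
have P0 : P 0 = 1 by rewrite /P rmorph1.
have P_rec i : ('X - 1) * P i = P i.+1 + P i.-1 := map_jacobi_poly_rec i.
(* Compare coefficients of z^t in (1 + w + w^2 - z w) S = 1 - w modulo w^(k+1), with z the outer and
   w the inner variable. *)
have c_rec t : eqmodr 'X^(k.+1) ((1 + 'X + 'X^2) * c t)
    (if t is t'.+1 then 'X * c t' else 1 - 'X).
  have := three_term_gf 'X%:P k.+1 P0 P_rec.
  set S := \sum_(i < _) _ => E.
  have ES s : S`_s = c s.
    rewrite /S /c coef_sum; apply: eq_bigr => i _.
    by rewrite -rmorphXn coefCM coef_map.
  have {}E : (1 + 'X + 'X^2)%:P * S - 'X%:P * ('X * S)
      = (1 - 'X)%:P + ('X^(k.+1))%:P * ('X%:P * P k - P k.+1).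
    have -> : (1 + 'X + 'X^2)%:P = 1 + 'X%:P + 'X%:P ^+ 2 :> {poly {poly int}}.
      by rewrite !rmorphD rmorph1 rmorphXn.
    have -> : (1 - 'X)%:P = 1 - 'X%:P :> {poly {poly int}} by rewrite rmorphB rmorph1.
    rewrite rmorphXn; move: E; rewrite /= exprS => E.
    transitivity ((1 - ('X - 1) * 'X%:P + 'X%:P ^+ 2) * S); first by ring.
    by rewrite E !exprS; ring.
  have := congr1 (fun p : {poly {poly int}} => p`_t) E.
  rewrite coefB !coefCM coefXM coefD coefCM coefC ES.
  case: t {E} => [|t] /=; rewrite ?ES.
    by rewrite mulr0 subr0 => ->; exists ('X%:P * P k - P k.+1)`_0.
  move/(canRL (subrK _)) ->.
  by exists ('X%:P * P k - P k.+1)`_t.+1; ring.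
have c_eq t : eqmodr 'X^(k.+1) ((1 + 'X + 'X^2) ^+ t.+1 * c t) ('X^t * (1 - 'X)).
  elim: t => [|t IHt]; first by rewrite mul1r; apply: c_rec.
  rewrite [_ ^+ t.+2]exprSr -mulrA; apply: eqmodr_trans (eqmodrMl _ (c_rec t.+1)) _.
  by rewrite mulrCA ['X^(t.+1)]exprS -mulrA; apply: eqmodrMl.
set t := (2 ^ J - 2)%N; rewrite -cE.
have t2 : t.+2 = (2 ^ J)%N.
  by rewrite /t; case: (J) J_gt0 => // j _; have := expn_gt0 2 j; rewrite expnS; lia.
(* The base is 1 + w^3 modulo 2, so [W] has even coefficients off the multiples of 3. Up to degree
   k, [W * c t] is w^t + w^(t + 2^J) modulo 2. *)
pose W : {poly int} := ((1 + 'X) * (1 + 'X + 'X^2)) ^+ t.+1.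
apply: (@dvd_residue_mulI 2 W (c t) k 1) => //.
- by rewrite -horner_coef0 /W !hornerE /= expr1n.
- rewrite /W -[t.+1]card_ord -prodr_const; apply: dvd_off3_prod => i j nj.
  rewrite (_ : _ * _ = 1 + 'X^3 + ('X + 'X^2) *+ 2); last by ring.
  rewrite 2!coefD coefMn coef1 coefXn.
  have /negPf-> : j != 0%N by lia.
  have /negPf-> : j != 3 by lia.
  by rewrite !add0r (dvdz_mulrn _ 2).
- move=> i le_ik i1.
  have E := eqmodrMl ((1 + 'X) ^+ t.+1) (c_eq t).
  rewrite /W exprMn -mulrA (eqmodrXn_coef E) //.
  have [h Eh] := expr_2X_congr ('X : {poly int}) J.
  have E2 : eqmodr 2%:R ((1 + 'X) ^+ t.+1 * ('X^t * (1 - 'X)))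
      ('X^t + 'X^(t + 2 ^ J) : {poly int}).
    exists ('X^t * (h - 'X * (1 + 'X) ^+ t.+1)).
    have -> : (1 + 'X) ^+ t.+1 * ('X^t * (1 - 'X))
        = 'X^t * ((1 + 'X) ^+ t.+2 - 2 * 'X * (1 + 'X) ^+ t.+1) :> {poly int}.
      by rewrite [_ ^+ t.+2]exprS; ring.
    by rewrite t2 Eh exprD; ring.
  apply: (eqmodr_nat_coef E2); rewrite coefD !coefXn.
  clear E E2 Eh h W.
  have [J3|J3] : (2 ^ J %% 3 = 1 \/ 2 ^ J %% 3 = 2)%N.
    by elim: (J) => [|j [] IH]; [left | right | left]; rewrite // expnS -modnMmr IH.
  all: move: J3 t2; move: (2 ^ J)%N t => e t' e3 t'2.
  all: have /negPf-> : i != t' by lia.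
  all: by have /negPf-> : i != (t' + e)%N by lia.
Qed.

(** * Sums over increasing tuples *)

Lemma big_tcons (A : nmodType) (T : finType) t (Q : pred (seq T)) (F : seq T -> A) :
  \sum_(s : t.+1.-tuple T | Q s) F s
    = \sum_(x : T) \sum_(s : t.-tuple T | Q (x :: s)) F (x :: s).
Proof.
rewrite pair_big_dep /=.
rewrite (reindex (fun p : T * t.-tuple T => [tuple of p.1 :: p.2])) //=.
exists (fun s => (thead s, [tuple of behead s])) => [[x s] _ | s _] /=.
  by congr pair; apply: val_inj.
by rewrite [RHS]tuple_eta.
Qed.

Section IncreasingTuples.
Variables (A : comNzRingType) (u : nat -> A) (n : nat).

(** The sum is sorted by the smallest index [y] whose factor contributes ['X]. As factor i carries
    [u i.+1], the range [y <= i] holds exactly the larger indices. *)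
Lemma coef_prod_1DX x t : (x <= n)%N ->
  (\prod_(x <= i < n) (1 + (u i.+1)%:P * 'X))`_t.+1
    = \sum_(x.+1 <= y < n.+1) u y * (\prod_(y <= i < n) (1 + (u i.+1)%:P * 'X))`_t.
Proof.
move=> /subnKC; move: (n - x)%N => d; elim: d x => [|d IHd] x Dn.
  by rewrite !big_geq ?coef1 //; lia.
have lt_xn : (x < n)%N by lia.
rewrite big_ltn // [RHS]big_ltn // -IHd; last by lia.
by rewrite mulrDl mul1r coefD addrC -mulrA coefCM coefXM.
Qed.

Lemma sum_increasing x t : (x <= n)%N ->
  \sum_(s : t.-tuple 'I_n.+1 | path ltn x (map val s)) \prod_(m <- map val s) u m
    = (\prod_(x <= i < n) (1 + (u i.+1)%:P * 'X))`_t.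
Proof.
elim: t x => [|t IHt] x le_xn.
  rewrite (big_pred1 [tuple]) => [|s]; last by rewrite tuple0 /= eqxx.
  rewrite big_nil -horner_coef0 horner_prod big1 // => i _.
  by rewrite !hornerE.
rewrite coef_prod_1DX // big_geq_mkord.
rewrite (big_tcons _ (fun s => path ltn x (map val s))
  (fun s => \prod_(m <- map val s) u m)).
rewrite [RHS]big_mkcond; apply: eq_bigr => y _ /=.
case: ltnP => [lt_xy|le_yx]; last first.
  by rewrite big_pred0.
rewrite -(IHt y) -1?ltnS ?ltn_ord //= mulr_sumr; apply: eq_bigr => s _.
by rewrite big_cons.
Qed.

End IncreasingTuples.

(** * [MO] as a coefficient of a finite product *)

(* The inverse of [1 + a q^m + q^(2m)] modulo [q^(n+1)]. *)
Definition MO_factor (a : int) n m : {poly int} :=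
  \sum_(k < n.+1) (1 - (1 + a *: 'X^m + 'X^(2 * m))) ^+ k.

Lemma MO_factorP a n m : (0 < m)%N ->
  eqmodr 'X^(n.+1) ((1 + a *: 'X^m + 'X^(2 * m)) * MO_factor a n m) 1.
Proof.
case: m => // m _; rewrite /MO_factor; set p := 1 + _ + _.
(* Since 1 - p is ['X] times the inner bracket, the telescoped sum leaves the remainder (1 -
   p)^(n+1). *)
exists (- (- a *: 'X^m - 'X^(m + m.+1)) ^+ n.+1).
rewrite mulrN -exprMn.
have -> : 'X * (- a *: 'X^m - 'X^(m + m.+1)) = 1 - p.
  rewrite /p mul2n -addnn addSn [in RHS]exprS ['X^((m + m.+1).+1)]exprS.
  by rewrite -!mul_polyC rmorphN; ring.
have {1}-> : p = - ((1 - p) - 1) by ring.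
by rewrite mulNr -subrX1 opprB.
Qed.

Lemma coef_MO_term a n (s : seq nat) : path ltn 0 s ->
  MO_term a s n = (\prod_(m <- s) ('X^m * MO_factor a n m))`_n.
Proof.
move=> s_gt0; rewrite big_split /= /MO_term /fps_mul.
have -> : \prod_(m <- s) 'X^m = 'X^(sumn s) :> {poly int}.
  by rewrite sumnE (big_morph _ (exprD 'X) (expr0 'X)).
rewrite coefM; apply: eq_bigr => i _; congr (_ * _).
(* The truncation order n stays fixed while the degree falls, so the induction on [s] treats all
   degrees k <= n. *)
have: (n - i <= n)%N by apply: leq_subr.
have: all (ltn 0) s by move: s_gt0; rewrite (path_sortedE ltn_trans) => /andP[].
move: (n - i)%N {s_gt0}; elim: s => [|m s IHs] k /=.
  by rewrite !big_nil coef1.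
move=> /andP[m_gt0 s_gt0] le_kn; rewrite !big_cons coefM /fps_mul.
apply: eq_bigr => j _; rewrite IHs //; last by lia.
rewrite (fps_inv_polyE (MO_denom0 _ m_gt0) (_ : j <= n)%N) //.
by have := ltn_ord j; lia.
Qed.

(** The outer variable z marks the length of the tuple; the inner one is q. *)
Lemma MO_coef a t n :
  MO a t n = (\prod_(i < n) (1 + ('X^(i.+1) * MO_factor a n i.+1)%:P * 'X))`_t`_n.
Proof.
rewrite -(big_mkord xpredT (fun i => 1 + ('X^(i.+1) * MO_factor a n i.+1)%:P * 'X)).
rewrite -(sum_increasing (fun m => 'X^m * MO_factor a n m)) // coef_sum.
by apply: eq_bigr => s /coef_MO_term.
Qed.

(** * Assembling the congruence modulo 4 *)

Lemma triangular_mod3 k : ('C(k.+1, 2) %% 3 = (k %% 3 == 1))%N.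
Proof.
elim/ltn_ind: k => -[|[|[|k]]] // IHk.
have /IHk: (k < k.+3)%N by lia.
rewrite !binS !bin1 !bin0; lia.
Qed.

Theorem theorem4p2 (J N : nat) (hJ : (2 <= J)%N) :
  (MO (-1) (2 ^ J - 2)%N (3 * N + 2)%N = 0 %[mod 4])%Z.
Proof.
set t := (2 ^ J - 2)%N; set n := (3 * N + 2)%N.
pose P k : {poly {poly int}} := (jacobi_poly k)^:P.
have P0 : P 0 = 1 by rewrite /P rmorph1.
have P_rec k : ('X - 1) * P k = P k.+1 + P k.-1 := map_jacobi_poly_rec k.
pose I m : {poly {poly int}} := (MO_factor (-1) n m)%:P.
have pI m : (0 < m)%N ->
    eqmodr ('X%:P ^+ n.+1) ((1 - 'X%:P ^+ m + 'X%:P ^+ m ^+ 2) * I m) 1.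
  move=> /(MO_factorP (-1) n)[h Eh]; exists h%:P.
  have := congr1 polyC Eh; rewrite scaleN1r mulnC exprM rmorphM.
  by rewrite !rmorphD rmorphN rmorph1 !rmorphXn [in RHS]rmorphM rmorphXn.
have [h] := MO_product_congr P0 P_rec pI.
set W := \prod_(i < n) (1 + ('X : {poly int}) ^+ i.+1 ^+ 3).
set D := \prod_(i < n) (1 + 2 * \sum_(j < n) ('X : {poly int}) ^+ i.+1 ^+ j.+1).
pose E : {poly {poly int}} :=
  \prod_(i < n) (1 + ('X^(i.+1) * MO_factor (-1) n i.+1)%:P * 'X).
have -> : \prod_(i < n) (1 + 'X%:P ^+ i.+1 ^+ 3) = W%:P :> {poly {poly int}}.
  by rewrite rmorph_prod; apply: eq_bigr => i _; rewrite rmorphD rmorph1 !rmorphXn.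
have -> : \prod_(i < n) (1 + 2 * \sum_(j < n) 'X%:P ^+ i.+1 ^+ j.+1)
    = D%:P :> {poly {poly int}}.
  rewrite rmorph_prod; apply: eq_bigr => i _.
  rewrite rmorphD rmorph1 rmorphM rmorph_nat rmorph_sum; congr (1 + 2 * _).
  by apply: eq_bigr => j _; rewrite !rmorphXn.
have -> : \prod_(i < n) (1 + 'X * ('X%:P ^+ i.+1 * I i.+1)) = E.
  by apply: eq_bigr => i _; rewrite mulrC rmorphM rmorphXn.
move=> /(congr1 (fun p : {poly {poly int}} => p`_t)).
rewrite -rmorphXn coefD !coefCM => EWE.
have {}EWE : eqmodr 'X^(n.+1) (W * E`_t)
    (D * \sum_(k < n.+1) 'X^('C(k.+1, 2)) * ((jacobi_poly k)`_t)%:P).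
  exists h`_t; rewrite EWE; congr (D * _ + _); rewrite coef_sum.
  by apply: eq_bigr => k _; rewrite -rmorphXn coefCM coef_map.
have dvdE : (4 %| (E`_t)`_n)%Z.
  apply: (@dvd_residue_mulI 4 W E`_t n 2) => //; last first.
  - by rewrite /n; lia.
  - move=> i le_in i2; rewrite (eqmodrXn_coef EWE) // mulr_sumr coef_sum.
    apply: rpred_sum => k _; rewrite mulrA coefMC -/D.
    rewrite mulrC [D * _]mulrC coefXnM; case: ltnP => [|le]; first by rewrite mulr0.
    have [D2 D4] := overpartition_coef (i - 'C(k.+1, 2)) (erefl D).
    have T3 := triangular_mod3 k.
    (* The index of [D] is 1 modulo 3, hence positive, when k is 1 modulo 3, and it is 2 modulo 3
       otherwise. *)
    have [k1|k1] := eqVneq (k %% 3)%N 1%N.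
      apply: (@dvdz_mul 2 2).
        by apply: jacobi_poly_coef_even => //; apply: leq_trans hJ.
      by apply: D2; move: T3; rewrite k1 eqxx /=; lia.
    apply: dvdz_mull; apply: D4; move: T3; rewrite (negPf k1) /=; lia.
  - apply: dvd_off3_prod => i j nj; rewrite -exprM coefD coef1 coefXn.
    have /negPf-> : j != 0%N by lia.
    have /negPf-> : j != (i.+1 * 3)%N by lia.
    by rewrite addr0 dvdz0.
  - rewrite -horner_coef0 horner_prod big1 // => i _.
    by rewrite !hornerE /= expr0n /= expr0n addr0.
by rewrite MO_coef -/E mod0z; apply/dvdz_mod0P.
Qed.
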